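(* Assume that for every $\boldsymbol{k}\in\operatorname{Ind}_{\mathrm{BZ}}$ one has $$\varphi^{\pi}(\Theta(\boldsymbol{k}))\in V_{\mathrm{BZ}}\otimes\mathbb{Q}\langle\mathcal{B}\rangle\qquad\text{and}\qquad\varphi^{\pi}(\Theta(\boldsymbol{k}))=(\tau_{\mathrm{BZ}}\otimes\mathrm{id})\bigl(\varphi^{\pi}(\Theta(\boldsymbol{k}^{\dagger}))\bigr).$$ Then $I^{\mathrm{BZ}}_{\mathrm{dual}}\subset I_{\mathrm{CF}}$.
   Context: **Words.** $\mathbb{Q}\langle\mathcal{B}\rangle$ is the free noncommutative $\mathbb{Q}$-algebra on $\mathcal{B}=\{b_0,b_1,b_2,\dots\}$ with empty word $1$; $\mathbb{Q}\langle\mathcal{B}\rangle^{0}$ is the subspace spanned by $1$ and all words not ending with $b_0$. The stuffle product $*$ on $\mathbb{Q}\langle\mathcal{B}\rangle$ is the $\mathbb{Q}$-bilinear map with $1*u=u*1=u$ and $(b_iu)*(b_jv)=b_i(u*b_jv)+b_j(b_iu*v)+b_{i+j}(u*v)$ for $i,j\ge0$. Every $u\in\mathbb{Q}\langle\mathcal{B}\rangle$ is uniquely $u=u_0+u_1*b_0+\cdots+u_k*b_0^{*k}$ with $u_j\in\mathbb{Q}\langle\mathcal{B}\rangle^{0}$; put $\operatorname{reg}_*(u)=u_0$. **Formal $q$MPLs.** $q$ is a fixed complex number with $0<|q|<1$. For $X\subset\mathbb{Z}$, $q^X=\{q^n: n\in X\}$. $\hat{\mathcal{F}}$ is the set of formal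 symbols $\mathbb{L}_{k_1,\dots,k_d}(x_1,\dots,x_d)$ with $d\ge0$, $k_i\in\mathbb{Z}_{\ge1}$, $x_i\in\{z^hq^m: h\in\{0,\pm1\},\,m\in\mathbb{Z}\}$ and $x_i\cdots x_d\in zq^{\mathbb{Z}}\cup q^{\mathbb{Z}_{>0}}$ for $1\le i\le d$; the case $d=0$ is written $\mathbb{L}(\emptyset)$. Weight: $k_1+\cdots+k_d$. For $\mathcal{X}\subset\hat{\mathcal{F}}$, $\mathbb{Q}\mathcal{X}$ is the $\mathbb{Q}$-vector space with basis $\mathcal{X}$. Let $\Omega=\bigoplus_{b\in\{0\}\cup q^{\mathbb{Z}}}\mathbb{Q}e_b$, with formal symbols $e_b$. **Single-position difference $D$.** $\mathbb{L}_{k_1,\dots,k_d}(x_1,\dots,x_d)$ and $\mathbb{L}_{k_1,\dots,k_d}(x'_1,\dots,x'_d)$ in $\hat{\mathcal{F}}$ are adjacent if for some $j$: $x_i=x_i'$ for $i\ne j$, $x_j\in zq^{\mathbb{Z}}\cup z^{-1}q^{\mathbb{Z}}$, $x_j/x_j'\in\{q^{\pm1}\}$. For adjacent $u=\mathbb{L}_{k_1,\dots,k_d}(x_1,\dots,x_d)$ and $v=\mathbb{L}_{k_1,\dots,k_d}(x_1,\dots,qx_j,\dots,x_d)$ put - if $k_j>1$: $D(u,v)=\mathbb{L}_{k_1,\dots,k_j-1,\dots,k_d}(x_1,\dots,x_d)\otimes e_0$; - if $k_j=1$, $x_j=q^mz$: $D(u,v)=-A\otimes e_{q^{-m}}+B\otimes(e_{q^{-m}}-e_0)$;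 - if $k_j=1$, $x_j=q^{-m}z^{-1}$: $D(u,v)=A\otimes(e_{q^{-m}}-e_0)-B\otimes e_{q^{-m}}$; where $A=\mathbb{L}_{k_1,\dots,\widehat{k_j},\dots,k_d}(x_1,\dots,x_{j-1}x_j,\dots,x_d)$ (read as $\mathbb{L}_{k_2,\dots,k_d}(x_2,\dots,x_d)$ if $j=1$) and $B=\mathbb{L}_{k_1,\dots,\widehat{k_j},\dots,k_d}(x_1,\dots,x_jx_{j+1},\dots,x_d)$ (read as $0$ if $j=d$). If instead $v$ is obtained from $u$ by $x_j\mapsto q^{-1}x_j$, put $D(u,v)=-D(v,u)$. **$\mathcal{F}^n$, $\mathcal{F}$, standard path.** For $n\in\mathbb{Z}$, $\mathcal{F}^n$ is the set of $\mathbb{L}_{k_1,\dots,k_d}(x_1,\dots,x_d)\in\hat{\mathcal{F}}$ with $x_i\in\{vq^s: v\in\{1,zq^n,(zq^n)^{-1}\},\,0\le s\le k_i\}$ for all $i$; $\mathcal{F}=\bigcup_n\mathcal{F}^n$. For $u=\mathbb{L}_{k_1,\dots,k_d}(x_1(z),\dots,x_d(z))\in\mathcal{F}$, the level of a $z$-dependent position $i$ is the unique integer $r$ with $x_i=zq^r$ or $x_i=z^{-1}q^{1-r}$. Levels are computed from $u$ and remain fixed. Starting from $u$, replace the $z$-dependent entries one at a time by $x_i(z)\mapsto x_i(zq)$, in increasing order of level, entries of equal level from right to left. The resulting sequence $\operatorname{Std}(u)=(u_0,\dots,u_l)$, $u_0=u(z)$, $u_l=u(zq)$, is the standard path; it consists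 of elements of $\hat{\mathcal{F}}$ with consecutive ones adjacent. **$\partial$, $S$, $\varphi$.** $\partial\colon\mathbb{Q}\mathcal{F}\to\mathbb{Q}\mathcal{F}\otimes\Omega$ is $\mathbb{Q}$-linear with $\partial(u)=\sum_{i=1}^lD(u_{i-1},u_i)$ for $u\in\mathcal{F}$, $\operatorname{Std}(u)=(u_0,\dots,u_l)$; it lowers weight by one. $\mathcal{C}$ is the set of $z$-independent elements of $\mathcal{F}$. $\hat{\mathcal{C}}_z=\{\mathbb{L}_{k_1,\dots,k_d}(q^{n_1},\dots,q^{n_{d-1}},zq^{n_d}): d\ge1,n_i\in\mathbb{Z}\}\cup\{\mathbb{L}(\emptyset)\}$ and $\mathcal{C}^n_z=\{\mathbb{L}_{k_1,\dots,k_d}(q^{n_1},\dots,q^{n_{d-1}},zq^{n+n_d}): d\ge1,\,0\le n_i\le k_i\}\cup\{\mathbb{L}(\emptyset)\}$. $S\colon\mathbb{Q}\hat{\mathcal{C}}_z\otimes\Omega\to\mathbb{Q}\hat{\mathcal{C}}_z$ is $\mathbb{Q}$-linear with, for $d\ge1$, $S(\mathbb{L}_{k_1,\dots,k_d}(q^{n_1},\dots,zq^{n_d})\otimes e_0)=\mathbb{L}_{k_1,\dots,k_{d-1},k_d+1}(q^{n_1},\dots,zq^{n_d})$, $S(\mathbb{L}_{k_1,\dots,k_d}(q^{n_1},\dots,zq^{n_d})\otimes e_{q^{-r}})=-\mathbb{L}_{k_1,\dots,k_d,1}(q^{n_1},\dots,q^{n_{d-1}},q^{n_d-r},zq^r)$,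 $S(\mathbb{L}(\emptyset)\otimes e_{q^{-r}})=-\mathbb{L}_1(zq^r)$, $S(\mathbb{L}(\emptyset)\otimes e_0)=0$. The $\mathbb{Q}$-linear map $\varphi\colon\mathbb{Q}\mathcal{F}\to\mathbb{Q}\mathcal{C}\otimes\mathbb{Q}\hat{\mathcal{C}}_z$ is defined recursively on weight by $\varphi=(\mathrm{id}_{\mathbb{Q}\mathcal{C}}\otimes S)\circ(\varphi\otimes\mathrm{id}_\Omega)\circ\partial+\mathrm{Const}$, where for $u\in\mathcal{F}$, $\mathrm{Const}(u)=u\otimes\mathbb{L}(\emptyset)$ if $u\in\mathcal{C}$ and $0$ otherwise. One has $\varphi(\mathbb{Q}\mathcal{F}^n)\subset\mathbb{Q}\mathcal{C}\otimes\mathbb{Q}\mathcal{C}^n_z$. **$\pi$, $\pi_z$, $\varphi^\pi$.** For integers $0\le n_i\le k_i$ put $$F(k_1,\dots,k_d;n_1,\dots,n_d)=\sum_{s_1=0}^{k_1-n_1}\cdots\sum_{s_d=0}^{k_d-n_d}\left(\prod_{i=1}^d\binom{k_i-n_i}{s_i}\right)b_{k_1-s_1}\cdots b_{k_d-s_d}.$$ The $\mathbb{Q}$-linear maps $\pi\colon\mathbb{Q}\mathcal{C}\to\mathbb{Q}\langle\mathcal{B}\rangle^0$ and $\pi_z\colon\mathbb{Q}\mathcal{C}^0_z\to\mathbb{Q}\langle\mathcal{B}\rangle$ are $\pi(\mathbb{L}_{k_1,\dots,k_d}(q^{n_1},\dots,q^{n_d}))=\pi_z(\mathbb{L}_{k_1,\dots,k_d}(q^{n_1},\dots,q^{n_{d-1}},zq^{n_d}))=F(k_1,\dots,k_d;n_1,\dots,n_d)$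 and $\pi(\mathbb{L}(\emptyset))=\pi_z(\mathbb{L}(\emptyset))=1$. Put $\varphi^\pi=(\pi\otimes\pi_z)\circ\varphi\colon\mathbb{Q}\mathcal{F}^0\to\mathbb{Q}\langle\mathcal{B}\rangle^0\otimes\mathbb{Q}\langle\mathcal{B}\rangle$. **Confluence relations.** $\mathcal{G}=\{\mathbb{L}_{k_1,\dots,k_d}(x_1,\dots,x_d)\in\mathcal{F}^0: d=0\text{ or }x_d\ne z\}$; for $u\in\mathbb{Q}\mathcal{G}$, $u|_{z=1}\in\mathbb{Q}\mathcal{C}$ is obtained by setting $z=1$ in all arguments. $\mathcal{S}(\mathbb{Q}\langle\mathcal{B}\rangle^0)$ is the symmetric algebra over $\mathbb{Q}$, with product $\odot$ and unit $1_{\mathcal{S}}$; $1_{\mathbb{Q}\langle\mathcal{B}\rangle^0}$ is the empty word viewed in degree one; $m_\odot(u\otimes v)=u\odot v$. $I^{\mathrm{alg}}_{\mathrm{CF}}$ is the ideal of $\mathcal{S}(\mathbb{Q}\langle\mathcal{B}\rangle^0)$ generated by $1_{\mathbb{Q}\langle\mathcal{B}\rangle^0}-1_{\mathcal{S}}$ and all $m_\odot\circ(\mathrm{id}\otimes\operatorname{reg}_* )\circ\varphi^\pi(u)-\pi(u|_{z=1})$, $u\in\mathbb{Q}\mathcal{G}$; and $I_{\mathrm{CF}}=I^{\mathrm{alg}}_{\mathrm{CF}}\cap\mathbb{Q}\langle\mathcal{B}\rangle^0$. **BZ duality.** $\operatorname{Ind}_{\mathrm{BZ}}$ is the set of tuples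 $\boldsymbol{k}=(k_1,\dots,k_d)\in\mathbb{Z}_{\ge1}^d$ with $d=0$ or $k_d\ge2$. With $\{1\}^r$ denoting $r$ copies of $1$, each such $\boldsymbol{k}$ is uniquely $\boldsymbol{k}=(\{1\}^{d_1-1},c_1+1,\dots,\{1\}^{d_r-1},c_r+1)$ with $c_i,d_i\ge1$; its BZ dual is $\boldsymbol{k}^\dagger=(\{1\}^{c_r-1},d_r+1,\dots,\{1\}^{c_1-1},d_1+1)$. Put $F_{\mathrm{BZ}}(\boldsymbol{k})=(b_{k_1}+b_{k_1-1})\cdots(b_{k_d}+b_{k_d-1})$ and $V_{\mathrm{BZ}}=\operatorname{span}_{\mathbb{Q}}\{F_{\mathrm{BZ}}(\boldsymbol{k}):\boldsymbol{k}\in\operatorname{Ind}_{\mathrm{BZ}}\}\subset\mathbb{Q}\langle\mathcal{B}\rangle^0$ (this family is linearly independent). $\tau_{\mathrm{BZ}}\colon V_{\mathrm{BZ}}\to V_{\mathrm{BZ}}$ is the $\mathbb{Q}$-linear involution with $\tau_{\mathrm{BZ}}(F_{\mathrm{BZ}}(\boldsymbol{k}))=F_{\mathrm{BZ}}(\boldsymbol{k}^\dagger)$, and $I^{\mathrm{BZ}}_{\mathrm{dual}}=\operatorname{Im}(\mathrm{id}_{V_{\mathrm{BZ}}}-\tau_{\mathrm{BZ}})$. **$\Theta$.** For $\boldsymbol{k}=(k_1,\dots,k_d)\in\operatorname{Ind}_{\mathrm{BZ}}$, $$\Theta(\boldsymbol{k})=\sum_{\varepsilon_1,\dots,\varepsilon_d\in\{0,1\}}(-1)^{\sum_{i=1}^d\varepsilon_i}\,\mathbb{L}_{k_1,\dots,k_d}\left(q^{k_1-1+\varepsilon_2}z^{\varepsilon_1-\varepsilon_2},\dots,q^{k_d-1+\varepsilon_{d+1}}z^{\varepsilon_d-\varepsilon_{d+1}}\right)\in\mathbb{Q}\mathcal{F}^0,\qquad\varepsilon_{d+1}:=0.$$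 *)

(* Defs.v *)
From HB Require Import structures.
From mathcomp Require Import all_boot all_order all_algebra finmap.
From mathcomp.multinomials Require Import monalg.
From Stdlib Require Import ClassicalEpsilon.

Set Implicit Arguments.
Unset Strict Implicit.
Unset Printing Implicit Defensive.

Import Order.TTheory GRing.Theory Num.Theory.
Local Open Scope ring_scope.

(* [Free X] is the Q-vector space with basis X.  Every vector space of the
   theory comes with a basis, so the tensor product of [Free X] and [Free Y] is
   realised as [Free (X * Y)]. *)
Notation Free X := {malg rat[X%type]}.

Section FreeSpaces.
Variables (X : choiceType) (V : lmodType rat).

Definition lin (f : X -> V) (v : Free X) : V :=
  \sum_(x <- msupp v) v@_x *: f x.

Lemma linEw (f : X -> V) (d : {fset X}) (v : Free X) :
  (msupp v `<=` d)%fset -> lin f v = \sum_(x <- d) v@_x *: f x.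
Proof.
move=> sub; rewrite /lin [LHS](big_fset_incl _ sub) //= => x _ /mcoeff_outdom ->.
by rewrite scale0r.
Qed.

Lemma lin_is_linear (f : X -> V) : linear (lin f).
Proof.
move=> a u v; pose d := (msupp u `|` msupp v)%fset.
have su : (msupp u `<=` d)%fset by rewrite fsubsetUl.
have sv : (msupp v `<=` d)%fset by rewrite fsubsetUr.
have sau : (msupp (a *: u + v) `<=` d)%fset.
  apply: fsubset_trans (msuppD_le _ _) _; rewrite fsubUset sv andbT.
  exact: fsubset_trans (msuppZ_le _ _) su.
rewrite (linEw f su) (linEw f sv) (linEw f sau) scaler_sumr -big_split /=.
by apply: eq_bigr => x _; rewrite mcoeffD mcoeffZ scalerDl scalerA.
Qed.

HB.instance Definition _ (f : X -> V) :=
  GRing.isLinear.Build rat (Free X) V *:%R (lin f) (lin_is_linear f).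

Lemma linU (f : X -> V) x : lin f << x >> = f x.
Proof.
by rewrite (linEw f (d := [fset x]%fset)) ?msuppU_le // big_seq_fset1 mcoeffUU scale1r.
Qed.

End FreeSpaces.

Definition tens (X Y : choiceType) (v : Free X) (w : Free Y) : Free (X * Y) :=
  \sum_(x <- msupp v) \sum_(y <- msupp w) << v@_x * w@_y *g (x, y) >>.

(* [f] tensor [g], for linear maps [f] and [g] *)
Definition tmap (X Y X' Y' : choiceType) (f : Free X -> Free X')
    (g : Free Y -> Free Y') : Free (X * Y) -> Free (X' * Y') :=
  lin (fun p : X * Y => tens (f << p.1 >>) (g << p.2 >>)).

Notation word := {fmonom nat}.
Notation QB := {malg rat[word]}.

Definition bw (s : seq nat) : QB := << FMonom s >>.
Definition b (i : nat) : QB := bw [:: i].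

(* The default value 1 makes the empty word admissible. *)
Definition adm (w : word) : bool := last 1%N w != 0%N.
Definition QB0 (v : QB) : Prop := {subset msupp v <= adm}.

Fixpoint stuffle_word (u : seq nat) : seq nat -> QB :=
  match u with
  | [::] => bw
  | i :: u' =>
      fix stuffle_u (v : seq nat) : QB :=
        match v with
        | [::] => bw u
        | j :: v' => b i * stuffle_word u' v + b j * stuffle_u v'
                     + b (i + j) * stuffle_word u' v'
        end
  end.

Definition stuffle (u v : QB) : QB :=
  lin (fun p : word * word => stuffle_word p.1 p.2) (tens u v).

Definition stuffle_b0_exp (j : nat) : QB := iter j (stuffle (b 0)) 1.

Definition is_reg (u u0 : QB) : Prop :=
  exists us : seq QB,
    [/\ forall v, v \in us -> QB0 v,
        u = \sum_(j < size us) stuffle us`_j (stuffle_b0_exp j)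
      & u0 = us`_0].

(* Each [u] has exactly one [u0] such that [is_reg u u0]. *)
Definition reg (u : QB) : QB := epsilon (inhabits 0) (is_reg u).

(* The argument z^h q^m is the pair (h, m) (q is not a root of unity, so q^m
   determines m); the product of arguments is the sum of pairs.  The entry
   (k, (h, m)) is the index k with its argument, and a symbol is the sequence
   of its entries. *)
Notation entry := (nat * (int * int))%type.
Notation symbol := (seq entry).
Notation nilentry := (0%N, (0, 0) : int * int).

Definition idx (e : entry) : nat := e.1.
Definition arg (e : entry) : int * int := e.2.
Definition zexp (e : entry) : int := e.2.1.
Definition qexp (e : entry) : int := e.2.2.

Definition weight (u : symbol) : nat := sumn (map idx u).

(* membership in z q^Z or in q^(Z_{>0}) *)
Definition tail_ok (x : int * int) : bool :=
  (x.1 == 1) || ((x.1 == 0) && (0 < x.2)).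

Definition in_Fhat (u : symbol) : bool :=
  all (fun e => (0 < idx e)%N && (zexp e \in [:: 0; 1; -1])) u
  && all (fun i => tail_ok (\sum_(e <- drop i u) arg e)) (iota 0 (size u)).

(* z^h q^m = v q^s with v = (z q^n)^h and s = m - h n *)
Definition in_Fn (n : int) (u : symbol) : bool :=
  in_Fhat u && all (fun e => 0 <= qexp e - zexp e * n <= (idx e)%:Z) u.

Definition in_F (u : symbol) : Prop := exists n, in_Fn n u.

Definition z_indep (u : symbol) : bool := all (fun e => zexp e == 0) u.

(* See [in_CP] for the independence of the choice n = 0. *)
Definition in_C (u : symbol) : bool := z_indep u && in_Fn 0 u.

Lemma in_CP (u : symbol) : in_C u <-> (in_F u /\ z_indep u).
Proof.
split=> [/andP[zu Fu]|[[n /andP[hu au]] zu]]; first by split=> //; exists 0.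
rewrite /in_C /in_Fn zu hu /=; apply/allP => e eu.
by have := allP au e eu; rewrite (eqP (allP zu e eu)) !mul0r.
Qed.

(* [Some m] stands for e_{q^m} and [None] for e_0. *)
Notation omega := (option int).
Definition e_q (m : int) : Free omega := << Some m >>.
Definition e_0 : Free omega := << None >>.

Definition mul_arg (x : int * int) (u : symbol) (j : nat) : symbol :=
  let e := nth nilentry u j in set_nth nilentry u j (idx e, arg e + x).

Definition del (u : symbol) (j : nat) : symbol := take j u ++ drop j.+1 u.

Definition symA (u : symbol) (j : nat) : Free symbol :=
  let x := arg (nth nilentry u j) in
  if j is j'.+1 then << del (mul_arg x u j') j >> else << behead u >>.

Definition symB (u : symbol) (j : nat) : Free symbol :=
  let x := arg (nth nilentry u j) in
  if (j.+1 < size u)%N then << del (mul_arg x u j.+1) j >> else 0.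

(* D(u, v) for v obtained from u by multiplying the argument j (from 0) by q *)
Definition D_up (u : symbol) (j : nat) : Free (symbol * omega) :=
  let e := nth nilentry u j in
  let m := qexp e in
  if zexp e == 0 then 0
  else if (1 < idx e)%N then
    tens << set_nth nilentry u j ((idx e).-1, arg e) >> e_0
  else if zexp e == 1 then
    - tens (symA u j) (e_q (- m)) + tens (symB u j) (e_q (- m) - e_0)
  else
    tens (symA u j) (e_q m - e_0) - tens (symB u j) (e_q m).

Definition D (u v : symbol) : Free (symbol * omega) :=
  let j := find (fun i => nth nilentry u i != nth nilentry v i) (iota 0 (size u)) in
  if v == mul_arg (0, 1) u j then D_up u j
  else if u == mul_arg (0, 1) v j then - D_up v j
  else 0.

(* r with x = z q^r or x = z^{-1} q^{1-r} *)
Definition level (e : entry) : int :=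
  if zexp e == 1 then qexp e else 1 - qexp e.

Definition std_order (u : symbol) : seq nat :=
  let r i := level (nth nilentry u i) in
  sort (fun i j => (r i < r j) || ((r i == r j) && (j <= i)%N))
       [seq i <- iota 0 (size u) | zexp (nth nilentry u i) != 0].

(* x_j(z) |-> x_j(zq) *)
Definition shift_z (u : symbol) (j : nat) : symbol :=
  mul_arg (0, zexp (nth nilentry u j)) u j.

Definition Std (u : symbol) : seq symbol := u :: scanl shift_z u (std_order u).

Definition partial : Free symbol -> Free (symbol * omega) :=
  lin (fun u => let p := Std u in
    \sum_(i < (size p).-1) D (nth [::] p i) (nth [::] p i.+1)).

(* Only the values on the basis of QC_z^ tensor Omega are meaningful. *)
Definition Smap : Free (symbol * omega) -> Free symbol :=
  lin (fun p : symbol * omega =>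
    match rev p.1, p.2 with
    | [::], None => 0
    | [::], Some m => - << [:: (1%N, (1, - m))] >>
    | (k, (h, n)) :: t, None => << rev ((k.+1, (h, n)) :: t) >>
    | (k, (h, n)) :: t, Some m =>
        - << rev [:: (1%N, (1, - m)), (k, (0, n + m)) & t] >>
    end).

Definition Const : Free symbol -> Free (symbol * symbol) :=
  lin (fun u : symbol => if in_C u then << (u, [::]) >> else 0).

(* (id tensor S), after reassociation *)
Definition idS : Free ((symbol * symbol) * omega) -> Free (symbol * symbol) :=
  lin (fun p : (symbol * symbol) * omega =>
    tens << p.1.1 >> (Smap << (p.1.2, p.2) >>)).

(* [phi_rec n] is phi on the symbols of [in_F] of weight at most n, since
   [partial] lowers the weight by one. *)
Fixpoint phi_rec (n : nat) (v : Free symbol) : Free (symbol * symbol) :=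
  (if n is n'.+1 then idS (tmap (phi_rec n') id (partial v)) else 0) + Const v.

Definition phi : Free symbol -> Free (symbol * symbol) :=
  lin (fun u => phi_rec (weight u) << u >>).

(* The sum defining F factors as a product of noncommutative polynomials.  It
   depends only on the k_i and on the q-exponents, so that [pi_q] is both the
   map pi (on C) and the map pi_z (on C_z^0). *)
Definition Fpoly (s : seq (nat * nat)) : QB :=
  \prod_(p <- s) \sum_(i < (p.1 - p.2).+1) 'C(p.1 - p.2, i)%:R *: b (p.1 - i).

Definition pi_q : Free symbol -> QB :=
  lin (fun u => Fpoly [seq (idx e, `|qexp e|%N) | e <- u]).

Definition phi_pi (v : Free symbol) : Free (word * word) :=
  tmap pi_q pi_q (phi v).

(* The symmetric algebra of [QB0]: commutative polynomials in variables indexed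
   by the basis of [QB0], the unit 1_S being the empty monomial. *)
Notation word0 := {w : word | adm w}.
Notation SymQB0 := {malg rat[{cmonom word0}]}.

(* The inclusion of [QB0] in degree one: the empty word goes to a variable, not
   to 1.  Words outside [QB0] are sent to 0 and never matter. *)
Definition sym_inj : QB -> SymQB0 :=
  lin (fun w : word => if insub w : option word0 is Some w0
                       then << ucm w0 >> else 0).

Definition m_odot : Free (word * word) -> SymQB0 :=
  lin (fun p : word * word => sym_inj << p.1 >> * sym_inj << p.2 >>).

Definition gen_ideal (R : comNzRingType) (P : R -> Prop) (x : R) : Prop :=
  exists2 s : seq (R * R),
    (forall p, p \in s -> P p.2) & x = \sum_(p <- s) p.1 * p.2.

Definition in_G (u : symbol) : bool :=
  in_Fn 0 u && ((u == [::]) || (arg (last nilentry u) != (1, 0))).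

Definition at_z1 : Free symbol -> Free symbol :=
  lin (fun u : symbol => << [seq (idx e, (0, qexp e)) | e <- u] >>).

Inductive CF_generator : SymQB0 -> Prop :=
| CF_unit : CF_generator (sym_inj 1 - 1)
| CF_conf (v : Free symbol) : {subset msupp v <= in_G} ->
    CF_generator (m_odot (tmap id reg (phi_pi v)) - sym_inj (pi_q (at_z1 v))).

Definition I_CF (v : QB) : Prop :=
  QB0 v /\ gen_ideal CF_generator (sym_inj v).

Definition Ind_BZ (k : seq nat) : bool := all (leq 1) k && (1 < last 2 k)%N.

(* [:: (d_1, c_1); ...; (d_r, c_r)] to ({1}^(d_1 - 1), c_1 + 1, ...) *)
Definition of_blocks (s : seq (nat * nat)) : seq nat :=
  flatten [seq rcons (nseq p.1.-1 1%N) p.2.+1 | p <- s].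

Fixpoint blocks_from (d : nat) (k : seq nat) : seq (nat * nat) :=
  match k with
  | [::] => [::]
  | c :: k' => if c == 1%N then blocks_from d.+1 k'
               else (d, c.-1) :: blocks_from 1 k'
  end.
Definition blocks (k : seq nat) : seq (nat * nat) := blocks_from 1 k.

Definition dual_BZ (k : seq nat) : seq nat :=
  of_blocks [seq (p.2, p.1) | p <- rev (blocks k)].

Lemma of_blocksK (s : seq (nat * nat)) :
  all (fun p => (0 < p.1)%N && (0 < p.2)%N) s -> blocks (of_blocks s) = s.
Proof.
have H d n c r : blocks_from d (rcons (nseq n 1%N) c.+2 ++ r)
    = ((d + n)%N, c.+1) :: blocks_from 1 r.
  by elim: n d => [|n IH] d /=; rewrite ?addn0 // IH addSnnS.
elim: s => [|[[|d] [|c]] s IH] //= hs.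
by rewrite /blocks /of_blocks /= H add1n; congr cons; apply: IH.
Qed.

Lemma blocksK (k : seq nat) : Ind_BZ k ->
  of_blocks (blocks k) = k
  /\ all (fun p => (0 < p.1)%N && (0 < p.2)%N) (blocks k).
Proof.
have H d : (0 < d)%N -> all (leq 1) k -> (1 < last 2 k)%N ->
    of_blocks (blocks_from d k) = (if k is [::] then [::] else nseq d.-1 1%N ++ k)
    /\ all (fun p => (0 < p.1)%N && (0 < p.2)%N) (blocks_from d k).
  elim: k d => [|c k IH] d d0 //= /andP[c0 k1] lk.
  case: eqP => [c1|/eqP c1].
    have k2 : k != [::] by move: lk; rewrite c1; case: (k).
    have lk2 : (1 < last 2 k)%N by move: lk k2; case: (k).
    have [-> ->] := IH d.+1 isT k1 lk2; split=> //.
    case: (k) k2 => // a l _; rewrite c1 /=.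
    by case: d d0 => // d _ /=; elim: d => //= d ->.
  have lk2 : (1 < last 2 k)%N by move: lk; case: (k).
  have [e1 e2] := IH 1%N isT k1 lk2.
  case: c c0 c1 {lk} => [|[|c]] // _ _; split; last by rewrite /= e2 d0.
  by rewrite /of_blocks /= -/(of_blocks _) e1 cat_rcons; case: (k).
move=> /andP[k1 lk]; have [-> ->] := H 1%N isT k1 lk; split=> //.
by case: (k).
Qed.

Definition F_BZ (k : seq nat) : QB := \prod_(i <- k) (b i + b i.-1).

Definition V_BZ (v : QB) : Prop :=
  exists2 c : Free (seq nat), {subset msupp c <= Ind_BZ} & v = lin F_BZ c.

(* The inverse of the algebra automorphism b_0 |-> b_0, b_i |-> b_i + b_{i-1}:
   the coordinates of a vector of [V_BZ] in the family [F_BZ]. *)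
Definition coord_BZ : QB -> QB :=
  lin (fun w : word =>
    \prod_(i <- (w : seq nat)) \sum_(j < i.+1) (-1) ^+ (i - j) *: b j).

(* Only its restriction to [V_BZ], given by [tau_BZ_F], is meaningful. *)
Definition tau_BZ (v : QB) : QB :=
  lin (fun w : word => if Ind_BZ w then F_BZ (dual_BZ w) else 0) (coord_BZ v).

Lemma tau_BZ_is_linear : linear tau_BZ.
Proof. by move=> a u v; rewrite /tau_BZ /coord_BZ !linearP. Qed.

Lemma coord_BZM (u v : QB) : coord_BZ (u * v) = coord_BZ u * coord_BZ v.
Proof.
pose P (w : word) : QB :=
  \prod_(i <- (w : seq nat)) \sum_(j < i.+1) (-1) ^+ (i - j) *: b j.
have PM (x y : word) : P (mmul x y) = P x * P y by rewrite /P fmM big_cat.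
have U (c : rat) (w : word) : coord_BZ << c *g w >> = c%:MP * P w.
  by rewrite mul_malgC /coord_BZ (linEw _ msuppU_le) big_seq_fset1 mcoeffUU.
have C (c : rat) (w : QB) : w * c%:MP = c%:MP * w.
  rewrite [w]monalgE mulr_suml mulr_sumr; apply: eq_bigr => x _.
  by rewrite !malgM_def !fgmulUU mulm1 mul1m mulrC.
have Rg (R : nzRingType) (c d p r : R) :
    p * d = d * p -> c * d * (p * r) = c * p * (d * r).
  by move=> e; rewrite -mulrA (mulrA d) -e -!mulrA.
have A (c d : QB) : coord_BZ (c + d) = coord_BZ c + coord_BZ d.
  exact: linearD.
have Z : coord_BZ 0 = 0 by exact: linear0.
rewrite [u]monalgE [v]monalgE mulr_suml.
rewrite !(big_morph coord_BZ A Z) mulr_suml; apply: eq_bigr => x _.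
rewrite mulr_sumr (big_morph coord_BZ A Z) mulr_sumr; apply: eq_bigr => y _.
rewrite malgM_def fgmulUU (U _ (mmul x y)) (U _ x) (U _ y) PM.
move: (P x) (P y) (u@_x) (v@_y) => p r c d.
have -> : (c * d)%:MP = c%:MP * d%:MP :> QB by exact: mpolyCM.
by apply: (Rg QB); apply: C.
Qed.

Lemma coord_BZ_F (k : seq nat) : all (leq 1) k -> coord_BZ (F_BZ k) = bw k.
Proof.
have UU (x y : seq nat) : bw x * bw y = bw (x ++ y).
  by rewrite /bw malgM_def fgmulUU mulr1; congr mkmalgU; apply/eqP; rewrite fmP fmM.
have C1 : coord_BZ 1 = 1 by rewrite /coord_BZ linU fm1 big_nil.
elim: k => [|i k IH] /=.
  rewrite /F_BZ big_nil C1 => _.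
  by congr mkmalgU; apply/eqP; rewrite fmP fm1.
case/andP=> i0 k1; rewrite /F_BZ big_cons -/(F_BZ k) coord_BZM IH //.
suff -> : coord_BZ (b i + b i.-1) = b i by rewrite UU.
case: i i0 => // i _; rewrite /coord_BZ linearD /= !linU !big_seq1 /=.
rewrite big_ord_recr /= subnn expr0 scale1r addrAC -big_split /= big1 ?add0r //.
move=> j _; rewrite subSn; last exact: (ltn_ord j).
by rewrite exprS mulN1r scaleNr addNr.
Qed.

Lemma tau_BZ_F (k : seq nat) : Ind_BZ k -> tau_BZ (F_BZ k) = F_BZ (dual_BZ k).
Proof.
by move=> hk; rewrite /tau_BZ coord_BZ_F ?linU /= ?hk //; case/andP: hk.
Qed.

Definition I_BZ_dual (v : QB) : Prop :=
  exists2 w, V_BZ w & v = w - tau_BZ w.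

Definition V_BZ_tens (t : Free (word * word)) : Prop :=
  exists2 s : seq (QB * QB),
    (forall p, p \in s -> V_BZ p.1) & t = \sum_(p <- s) tens p.1 p.2.

Definition Theta (k : seq nat) : Free symbol :=
  \sum_(eps : (size k).-tuple bool)
    let ep i : int := (nth false eps i : nat)%:Z in
    (-1) ^+ count id eps *:
    << mkseq (fun i =>
         let ki := nth 0%N k i in
         (ki, (ep i - ep i.+1, ki%:Z - 1 + ep i.+1)) : entry) (size k) >>.

(* Main.v *)
Require Import Defs.
From HB Require Import structures.
From mathcomp Require Import all_boot all_order all_algebra finmap.
From mathcomp.multinomials Require Import monalg.
From mathcomp Require Import zify.
From Stdlib Require Import ClassicalEpsilon.

(** The idea.  Write [k'] for the dual of [k] and call left weight the weight of
    the first tensor factor.  Since [D] lowers the weight by one and [S] acts on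
    the right factor only, [phi u] is [Const u] plus terms of left weight smaller
    than the weight of [u] ([phi_lead]).  In [Theta k] only the summand with all
    [epsilon_i] zero is free of [z], so

      [phi_pi (Theta k) = F_BZ k (x) 1 + r],  left weight of [r] < weight of [k]

    ([phi_pi_Theta_lead]).  On the other hand [Theta k] lies in [Q G], and once
    [z = 1] its summands no longer depend on [epsilon_1] except by sign, so
    they cancel in pairs for nonempty [k] ([pi_q_at_z1_Theta]).  The confluence
    relation of [Theta k] thus says that [m_odot o (id (x) reg)] sends [phi_pi (Theta k)]
    into the ideal ([conf_lhs_Theta]); the same holds for [Theta k'], and the
    assumed identity for [k'] reads [phi_pi (Theta k') = (tau (x) id) (phi_pi
    (Theta k))] because duality is an involution.  Subtracting, the ideal contains
    the image of [phi_pi (Theta k)] under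
    [m_odot o ((id - tau) (x) reg)] (this map is [dual_defect]).

    The leading term contributes [F_BZ k - F_BZ k'], using [reg 1 = 1] and the
    generator which identifies the empty word with the unit.  The remainder [r]
    is in [V_BZ (x) QB], and the triangular change of coordinates [coord_BZ] shows
    that its left factors are combinations of [F_BZ l] with [l] of weight smaller
    than that of [k]; its contribution is in the ideal by induction on the weight
    ([dual_in_ideal_F_BZ]).

    That [reg 1 = 1] requires the uniqueness of the expansion in stuffle powers
    of [b_0] ([is_reg_one_unique]).  It follows from a leading term computation:
    for admissible [u], the only words with at least [m] trailing zeros in
    [u * b_0^{*m}] are those of [m! u b_0^m] ([mcoeff_stuffle_b0_exp]). *)

Set Implicit Arguments.
Unset Strict Implicit.
Unset Printing Implicit Defensive.

Import Order.TTheory GRing.Theory Num.Theory.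
Local Open Scope ring_scope.

(** * Subspaces, supports, tensors and linear maps *)

(** Subspaces, as predicates closed under linear combinations. *)
Definition subspace (V : lmodType rat) (Q : V -> Prop) : Prop :=
  Q 0 /\ forall (a : rat) u v, Q u -> Q v -> Q (a *: u + v).

Section Subspace.
Variables (V : lmodType rat) (Q : V -> Prop).
Hypothesis subQ : subspace Q.

Lemma subspaceD u v : Q u -> Q v -> Q (u + v).
Proof. by move=> Qu Qv; rewrite -[u]scale1r; apply: subQ.2. Qed.

Lemma subspaceZ a u : Q u -> Q (a *: u).
Proof. by move=> Qu; rewrite -[_ *: _]addr0; apply: subQ.2 => //; case: subQ. Qed.

Lemma subspaceN u : Q u -> Q (- u).
Proof. by rewrite -scaleN1r; apply: subspaceZ. Qed.

Lemma subspaceB u v : Q u -> Q v -> Q (u - v).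
Proof. by move=> Qu Qv; apply: subspaceD => //; apply: subspaceN. Qed.

Lemma subspace_sum (I : eqType) (r : seq I) (P : pred I) (F : I -> V) :
  (forall i, i \in r -> P i -> Q (F i)) -> Q (\sum_(i <- r | P i) F i).
Proof.
move=> QF; rewrite big_seq_cond; apply: (big_ind Q); first by case: subQ.
  exact: subspaceD.
by move=> i /andP[]; apply: QF.
Qed.

Lemma subspace_lin (X : choiceType) (f : X -> V) (v : Free X) :
  (forall x, x \in msupp v -> Q (f x)) -> Q (lin f v).
Proof. by move=> Qf; apply: subspace_sum => x xv _; apply/subspaceZ/Qf. Qed.

End Subspace.

Lemma subspace_preim (V W : lmodType rat) (f : {linear V -> W}) (Q : W -> Prop) :
  subspace Q -> subspace (fun v => Q (f v)).
Proof.
by move=> [Q0 Qlin]; split=> [|a u v Qu Qv]; rewrite ?linear0 ?linearP //; apply: Qlin.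
Qed.

Lemma linear_sub (V W : lmodType rat) (f g : {linear V -> W}) :
  linear (fun v => f v - g v).
Proof. by move=> a u v; rewrite (linearP f) (linearP g) opprD addrACA scalerBr. Qed.

Lemma eq_subspace (V W : lmodType rat) (f g : {linear V -> W}) :
  subspace (fun v => f v = g v).
Proof. by split=> [|a u v fu fv]; rewrite ?linear0 // !linearP fu fv. Qed.

Lemma malgUZ (X : choiceType) (c : rat) (x : X) : << c *g x >> = c *: << x >>.
Proof. by apply/malgP => y; rewrite mcoeffZ !mcoeffU mulrnAr mulr1. Qed.

(** A linear map on a free space is determined by its values on the basis. *)
Lemma linear_lin (X : choiceType) (V : lmodType rat) (F : {linear Free X -> V})
    (v : Free X) : F v = lin (fun x => F << x >>) v.
Proof.
rewrite {1}[v]monalgE linear_sum; apply: eq_bigr => x _.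
by rewrite malgUZ linearZ.
Qed.

Lemma eq_linear (X : choiceType) (V : lmodType rat) (F G : {linear Free X -> V}) :
  (forall x, F << x >> = G << x >>) -> F =1 G.
Proof.
move=> FG v; rewrite (linear_lin F) (linear_lin G).
by apply: eq_bigr => x _; rewrite FG.
Qed.

(** [supp_in P v]: the vector [v] lies in the span of the basis elements
    satisfying [P]. *)
Definition supp_in (X : choiceType) (P : pred X) (v : Free X) : Prop :=
  {subset msupp v <= P}.

Section Supports.
Variables (X : choiceType) (P : pred X).

Lemma supp_in_subspace : subspace (supp_in P).
Proof.
split=> [x|a u v Pu Pv x]; first by rewrite msupp0.
move/(fsubsetP (msuppD_le _ _)); rewrite in_fsetU => /orP[|/Pv//].
by move/(fsubsetP (msuppZ_le _ _))/Pu.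
Qed.

Lemma supp_inU x : P x -> supp_in P << x >>.
Proof. by move=> Px y /(fsubsetP msuppU_le); rewrite in_fset1 => /eqP->. Qed.

Lemma supp_in_coef (v : Free X) x : supp_in P v -> ~~ P x -> v@_x = 0.
Proof.
by move=> Pv nPx; apply: mcoeff_outdom; apply: contra nPx => /Pv.
Qed.

Lemma sub_supp_in (P' : pred X) (v : Free X) :
  {subset P <= P'} -> supp_in P v -> supp_in P' v.
Proof. by move=> PP' Pv x /Pv/PP'. Qed.

End Supports.

Section Tensors.
Variables (X Y : choiceType).

Lemma tensE (v : Free X) (w : Free Y) :
  tens v w = lin (fun x => lin (fun y => << (x, y) >>) w) v.
Proof.
apply: eq_bigr => x _; rewrite /lin scaler_sumr; apply: eq_bigr => y _.
by rewrite scalerA malgUZ.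
Qed.

Lemma tens_linearl (w : Free Y) : linear (fun v : Free X => tens v w).
Proof. by move=> a u v; rewrite !tensE linearP. Qed.

Lemma tens_linearr (v : Free X) : linear (tens v : Free Y -> _).
Proof.
move=> a u w; rewrite !tensE /lin scaler_sumr -big_split; apply: eq_bigr => x _ /=.
by rewrite -!/(lin _ _) linearP scalerDr !scalerA mulrC.
Qed.

Lemma tensUU (x : X) (y : Y) : tens << x >> << y >> = << (x, y) >>.
Proof. by rewrite tensE !linU. Qed.

Lemma supp_in_tens (P : pred X) (P' : pred Y) v w : supp_in P v -> supp_in P' w ->
  supp_in (fun p => P p.1 && P' p.2) (tens v w).
Proof.
move=> Pv Pw; rewrite tensE.
apply: (subspace_lin (supp_in_subspace _)) => x /Pv Px.
apply: (subspace_lin (supp_in_subspace _)) => y /Pw Py.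
by apply: supp_inU; apply/andP.
Qed.

End Tensors.

HB.instance Definition _ (X Y : choiceType) (v : Free X) :=
  GRing.isLinear.Build rat (Free Y) (Free (X * Y)) *:%R (tens v) (tens_linearr v).

(** [tens] with its arguments exchanged, as a linear map in the left factor. *)
Definition tensr (X Y : choiceType) (w : Free Y) (v : Free X) := tens v w.

HB.instance Definition _ (X Y : choiceType) (w : Free Y) :=
  GRing.isLinear.Build rat (Free X) (Free (X * Y)) *:%R (tensr w) (tens_linearl w).

HB.instance Definition _ (X Y X' Y' : choiceType) (f : Free X -> Free X')
    (g : Free Y -> Free Y') := GRing.Linear.on (tmap f g).

Lemma tmapU (X Y X' Y' : choiceType) (f : Free X -> Free X')
    (g : Free Y -> Free Y') x y :
  tmap f g << (x, y) >> = tens (f << x >>) (g << y >>).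
Proof. by rewrite /tmap linU. Qed.

(** When the second factor is a basis vector, [g] need not be linear: [tmap]
    only uses its values on the basis.  This is what makes it applicable to the
    regularization map. *)
Lemma tmap_tensl (X Y X' Y' : choiceType) (f : {linear Free X -> Free X'})
    (g : Free Y -> Free Y') v y :
  tmap f g (tens v << y >>) = tens (f v) (g << y >>).
Proof.
have -> : tmap f g (tens v << y >>) = (tmap f g \o tensr << y >>) v by [].
have -> : tens (f v) (g << y >>) = (tensr (g << y >>) \o f) v by [].
by apply: eq_linear => x /=; rewrite /tensr tensUU tmapU.
Qed.

Lemma tmap_tens (X Y X' Y' : choiceType) (f : {linear Free X -> Free X'})
    (g : {linear Free Y -> Free Y'}) v w :
  tmap f g (tens v w) = tens (f v) (g w).
Proof.
have -> : tmap f g (tens v w) = (tmap f g \o tens v) w by [].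
have -> : tens (f v) (g w) = (tens (f v) \o g) w by [].
by apply: eq_linear => x /=; rewrite tmap_tensl.
Qed.

HB.instance Definition _ := GRing.Linear.on pi_q.
HB.instance Definition _ := GRing.Linear.on at_z1.
HB.instance Definition _ := GRing.Linear.on phi.
HB.instance Definition _ := GRing.Linear.on sym_inj.
HB.instance Definition _ := GRing.Linear.on m_odot.
HB.instance Definition _ := GRing.Linear.on coord_BZ.
HB.instance Definition _ :=
  GRing.isLinear.Build rat QB QB *:%R tau_BZ tau_BZ_is_linear.

(** * Words and the stuffle regularization of the empty word *)

Lemma eq_word (s : seq nat) (w : word) : (FMonom s == w) = (s == w :> seq nat).
Proof. by rewrite fmP. Qed.

Lemma bw_nil : bw [::] = 1.
Proof. by congr mkmalgU; apply/eqP; rewrite eq_word fm1. Qed.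

Lemma bwM s t : bw s * bw t = bw (s ++ t).
Proof.
by rewrite /bw malgM_def fgmulUU mulr1; congr mkmalgU; apply/eqP; rewrite fmP fmM.
Qed.

Lemma bw_word (w : word) : << w >> = bw w.
Proof. by case: w. Qed.

Lemma mcoeff_bw s t : (bw s)@_(FMonom t) = (s == t)%:R.
Proof. by rewrite mcoeffU1 eq_word. Qed.

Lemma mcoeff_bM i a s (v : QB) :
  (b i * v)@_(FMonom (a :: s)) = v@_(FMonom s) *+ (i == a).
Proof.
rewrite [v in LHS]monalgE [v in RHS]monalgE mulr_sumr !raddf_sum -sumrMnl /=.
apply: eq_bigr => x _; rewrite malgM_def fgmulUU mul1r !mcoeffU.
rewrite -mulrnA mulnb; congr (_ *+ (nat_of_bool _)).
by rewrite fmP fmM /= eqseq_cons andbC fmP.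
Qed.

Lemma supp_in_bM (P P' : pred word) i (v : QB) :
  (forall w : word, P w -> P' (FMonom (i :: w))) -> supp_in P v -> supp_in P' (b i * v).
Proof.
move=> PP' Pv w /msuppM_le[k1 [k2 [k1i /Pv/PP' k2v ->]]].
move/(fsubsetP msuppU_le): k1i; rewrite in_fset1 => /eqP->.
suff -> : mmul (FMonom [:: i]) k2 = FMonom (i :: k2) by [].
by apply/eqP; rewrite fmP fmM.
Qed.

(** The nonzero letters of a word, in order: stuffling with a power of [b_0]
    does not change them. *)
Definition nonzeros (s : seq nat) : seq nat := [seq i <- s | i != 0%N].

Lemma stuffle_word0 s : stuffle_word s [::] = bw s.
Proof. by case: s. Qed.

Lemma stuffle_wordS i s j t : stuffle_word (i :: s) (j :: t) =
  b i * stuffle_word s (j :: t) + b j * stuffle_word (i :: s) t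
  + b (i + j) * stuffle_word s t.
Proof. by []. Qed.

Lemma mcoeff_stuffle_cons i s j r a t :
  (stuffle_word (i :: s) (j :: r))@_(FMonom (a :: t)) =
  (stuffle_word s (j :: r))@_(FMonom t) *+ (i == a)
  + (stuffle_word (i :: s) r)@_(FMonom t) *+ (j == a)
  + (stuffle_word s r)@_(FMonom t) *+ (i + j == a)%N.
Proof. by rewrite stuffle_wordS 2!mcoeffD; congr (_ + _ + _); exact: mcoeff_bM. Qed.

Lemma stuffle_zeros_nonzeros s n :
  supp_in (fun w : word => nonzeros w == nonzeros s) (stuffle_word s (nseq n 0%N)).
Proof.
elim: s n => [|i s IHs] n.
  by apply: supp_inU; elim: n.
elim: n => [|n IHn]; first by apply: supp_inU => /=.
rewrite [nseq _ _]/= stuffle_wordS addn0.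
apply: (subspaceD (supp_in_subspace _)).
  apply: (subspaceD (supp_in_subspace _)).
    apply: (supp_in_bM _ (IHs n.+1)) => w /eqP /= ws.
    by rewrite /nonzeros /= -!/(nonzeros _) ws.
  by apply: (supp_in_bM _ IHn) => w /eqP /= ws; rewrite /nonzeros /= -!/(nonzeros _) ws.
apply: (supp_in_bM _ (IHs n)) => w /eqP /= ws.
by rewrite /nonzeros /= -!/(nonzeros _) ws.
Qed.

Lemma adm_cons i s : adm (FMonom (i :: s)) -> adm (FMonom s).
Proof. by case: s. Qed.

Lemma nonzeros_adm i s : adm (FMonom (i :: s)) -> nonzeros (i :: s) != [::].
Proof.
rewrite /nonzeros -has_filter => h.
by apply/hasP; exists (last i s); first exact: mem_last.
Qed.

Lemma nonzeros_nseq n : nonzeros (nseq n 0%N) = [::].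
Proof. by elim: n. Qed.

(** For admissible [s], the only word with at least [m] trailing zeros in
    [s * b_0^m] is [s b_0^m] itself, with coefficient one. *)
Lemma mcoeff_stuffle_zeros s t m n :
  adm (FMonom s) -> adm (FMonom t) -> (m <= n)%N ->
  (stuffle_word s (nseq m 0%N))@_(FMonom (t ++ nseq n 0%N))
  = ((s == t) && (m == n))%:R.
Proof.
elim: s m t n => [|i s IHs] m t n adms admt.
  move=> _; rewrite mcoeff_bw; congr (nat_of_bool _)%:R.
  case: t admt => [|a t] /= admt.
    by apply/eqP/eqP => [/(congr1 size)|->//]; rewrite !size_nseq.
  (* A nonempty admissible word has a nonzero letter. *)
  apply/eqP => /(congr1 nonzeros); rewrite nonzeros_nseq.
  rewrite -cat_cons /nonzeros filter_cat -!/(nonzeros _) nonzeros_nseq cats0.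
  by move/esym/eqP; apply/negP/nonzeros_adm.
elim: m t n admt => [|m IHm] t n admt mn.
  rewrite [nseq _ _]/= stuffle_word0 mcoeff_bw; congr (nat_of_bool _)%:R.
  case: n {mn} => [|n]; first by rewrite cats0 andbT.
  rewrite andbF; apply/eqP => /(congr1 (last 1%N)).
  rewrite last_cat /= => e; move: adms; rewrite /adm /= in e *.
  rewrite e; suff -> : last 0%N (nseq n 0%N) = 0%N by [].
  by elim: (n).
(* The empty [t] is excluded by the nonzero letters; otherwise only the first
   term of the stuffle recursion can reach the coefficient, as [m < n]. *)
case: t admt => [|a t] admt.
  rewrite (supp_in_coef (@stuffle_zeros_nonzeros (i :: s) m.+1)) //.
  rewrite cat0s -[X in X != _]/(nonzeros (nseq n 0%N)) nonzeros_nseq.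
  have := nonzeros_adm adms.
  by rewrite eq_sym.
rewrite [nseq m.+1 _]/= cat_cons mcoeff_stuffle_cons addn0.
have nm : (m == n) = false by apply/eqP => e; rewrite e ltnn in mn.
have IH1 := IHs m.+1 t n (adm_cons adms) (adm_cons admt) mn.
rewrite [nseq m.+1 _]/= in IH1; rewrite IH1.
rewrite IHm ?IHs ?(adm_cons adms) ?(adm_cons admt) ?(ltnW mn) //.
rewrite nm !andbF !mul0rn !addr0 eqseq_cons.
by case: (i == a) (s == t) (m.+1 == n) => [] [] [].
Qed.

Lemma stuffleUU (v w : word) : stuffle << v >> << w >> = stuffle_word v w.
Proof. by rewrite /stuffle tensUU linU. Qed.

Lemma stuffle_linear (v : QB) : linear (stuffle v).
Proof. by move=> a u w; rewrite /stuffle !linearP. Qed.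

HB.instance Definition _ (v : QB) :=
  GRing.isLinear.Build rat QB QB *:%R (stuffle v) (stuffle_linear v).

(** The words [b_0^i] with [i < n]. *)
Definition lower_zeros (n : nat) (w : word) : bool :=
  ((w : seq nat) == nseq (size w) 0%N) && (size w < n)%N.

Lemma stuffle_b0_zeros n : stuffle (b 0) (bw (nseq n 0%N))
  = n.+1%:R *: bw (nseq n.+1 0%N) + n%:R *: bw (nseq n 0%N).
Proof.
rewrite !scaler_nat.
rewrite stuffleUU -[LHS]/(stuffle_word [:: 0%N] (nseq n 0%N)).
elim: n => [|n IHn]; first by rewrite /= mulr0n addr0.
rewrite [nseq n.+1 _]/= stuffle_wordS IHn /= !bwM mulrDr !mulrnAr !bwM /=.
by rewrite addn0 (mulrS _ n.+1) [X in _ = _ + X]mulrSr !addrA.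
Qed.

(** [b_0^{*n}] is [n! b_0^n] plus lower powers. *)
Lemma stuffle_b0_exp_lead n : exists2 r, supp_in (lower_zeros n) r &
  stuffle_b0_exp n = n`!%:R *: bw (nseq n 0%N) + r.
Proof.
elim: n => [|n [r rn En]].
  by exists 0; [case: (supp_in_subspace (lower_zeros 0)) | rewrite scale1r addr0 bw_nil].
exists ((n`!%:R * n%:R) *: bw (nseq n 0%N) + stuffle (b 0) r).
  have sub := supp_in_subspace (lower_zeros n.+1).
  have low m : (m < n.+1)%N -> supp_in (lower_zeros n.+1) (bw (nseq m 0%N)).
    by move=> mn; apply: supp_inU; rewrite /lower_zeros /= size_nseq eqxx.
  apply: (subspaceD sub); first by apply/(subspaceZ sub)/low.
  rewrite (linear_lin (stuffle (b 0))).
  apply: (subspace_lin sub) => w /rn /andP[/eqP ew wn].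
  rewrite /= (bw_word w) ew stuffle_b0_zeros.
  by apply: (subspaceD sub); apply/(subspaceZ sub)/low; rewrite ?ltnS // ltnW.
rewrite /stuffle_b0_exp iterS -/(stuffle_b0_exp n) En linearD linearZ.
have -> : (n.+1)`!%:R = n`!%:R * n.+1%:R :> rat by rewrite factS natrM mulrC.
have distr (V : lmodType rat) (a c d : rat) (x y z : V) :
    a *: (c *: x + d *: y) + z = (a * c) *: x + ((a * d) *: y + z).
  by rewrite scalerDr !scalerA addrA.
rewrite [LHS]/= (stuffle_b0_zeros n).
exact: distr.
Qed.

Lemma stuffle_linearl (w : QB) : linear (fun v => stuffle v w).
Proof. by move=> a u v; rewrite /stuffle -linearP; congr (lin _ _); rewrite !tensE linearP. Qed.

(** The stuffle product as a linear map in its left factor. *)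
Definition stuffler (w v : QB) : QB := stuffle v w.

HB.instance Definition _ (w : QB) :=
  GRing.isLinear.Build rat QB QB *:%R (stuffler w) (stuffle_linearl w).

Lemma coef0_subspace (w : word) : subspace (fun v : QB => v@_w = 0).
Proof.
by split=> [|a u v u0 v0]; rewrite ?mcoeff0 // mcoeffD mcoeffZ u0 v0 mulr0 addr0.
Qed.

Lemma mcoeff_stuffle_lower_zeros (u r : QB) m n t :
  QB0 u -> supp_in (lower_zeros m) r -> adm (FMonom t) -> (m <= n)%N ->
  (stuffle u r)@_(FMonom (t ++ nseq n 0%N)) = 0.
Proof.
move=> u0 rm admt mn.
rewrite /stuffle; apply: (subspace_lin (coef0_subspace _)) => -[v w].
move/(supp_in_tens u0 rm) => /andP[/= vadm /andP[/eqP ew wm]].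
rewrite ew mcoeff_stuffle_zeros ?fmK //; last exact: leq_trans (ltnW wm) mn.
by rewrite [_ == n]ltn_eqF ?andbF // (leq_trans wm mn).
Qed.

Lemma mcoeff_sum (X : choiceType) (x : X) (I : Type) (r : seq I) (F : I -> Free X) :
  (\sum_(i <- r) F i)@_x = \sum_(i <- r) (F i)@_x.
Proof. exact: raddf_sum. Qed.

Lemma mcoeff_stuffle_bw_zeros (u : QB) m n t :
  QB0 u -> adm (FMonom t) -> (m <= n)%N ->
  (stuffle u (bw (nseq m 0%N)))@_(FMonom (t ++ nseq n 0%N))
  = u@_(FMonom t) *+ (m == n).
Proof.
move=> u0 admt mn; rewrite -[stuffle u _]/(stuffler (bw (nseq m 0%N)) u).
rewrite linear_lin /lin mcoeff_sum.
transitivity (\sum_(x <- msupp u) u@_x *+ (x == FMonom t) *+ (m == n)).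
  apply: eq_big_seq => x xu; rewrite mcoeffZ.
  rewrite [in LHS]/= /stuffler stuffleUU mcoeff_stuffle_zeros ?fmK //; last exact: u0.
  rewrite -[RHS]mulrnA mulnb -[RHS]mulr_natr; congr (_ * (nat_of_bool (_ && _))%:R).
rewrite sumrMnl; congr (_ *+ _); rewrite [u in RHS]monalgE mcoeff_sum.
by apply: eq_bigr => x _; rewrite mcoeffU.
Qed.

(** For admissible [u], the words with at least [m] trailing zeros in
    [u * b_0^{*m}] are those of [m! u b_0^m]. *)
Lemma mcoeff_stuffle_b0_exp (u : QB) m n t :
  QB0 u -> adm (FMonom t) -> (m <= n)%N ->
  (stuffle u (stuffle_b0_exp m))@_(FMonom (t ++ nseq n 0%N))
  = m`!%:R * u@_(FMonom t) *+ (m == n).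
Proof.
move=> u0 admt mn; have [r rm ->] := stuffle_b0_exp_lead m.
have E := mcoeff_stuffle_lower_zeros u0 rm admt mn.
have E' := mcoeff_stuffle_bw_zeros u0 admt mn.
move: (m`!%:R) => f.
rewrite linearD linearZ mcoeffD mcoeffZ.
rewrite [X in _ + X]E.
rewrite [X in _ * X]E' addr0.
by rewrite mulrnAr.
Qed.

Lemma adm_zeros_eq0 (u : QB) : QB0 u ->
  (forall t, adm (FMonom t) -> u@_(FMonom t) = 0) -> u = 0.
Proof.
move=> u0 ut; apply/malgP => -[t]; rewrite mcoeff0.
case: (boolP (adm (FMonom t))) => [/ut//|]; exact: supp_in_coef.
Qed.

(** In an expansion of 1, the coefficients [u_j] with [j > 0] vanish, by
    descending induction on [j]: the words [t b_0^j] only arise from [u_j]. *)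
Lemma is_reg_one_unique u0 : is_reg 1 u0 -> u0 = 1.
Proof.
case=> us [us0 e ->]; have us0n j : QB0 us`_j.
  case: (ltnP j (size us)) => [/(mem_nth 0)/us0//|/(nth_default 0)->].
  by move=> x; rewrite msupp0.
have coef n t : adm (FMonom t) -> (forall j, (n < j)%N -> us`_j = 0) ->
    (1 : QB)@_(FMonom (t ++ nseq n 0%N)) = n`!%:R * us`_n@_(FMonom t).
  move=> admt usn; rewrite e raddf_sum /=.
  have E (j : 'I_(size us)) :
      (stuffle us`_j (stuffle_b0_exp j))@_(FMonom (t ++ nseq n 0%N))
      = n`!%:R * us`_n@_(FMonom t) *+ (j == n :> nat).
    have [jn|nj] := leqP j n; last first.
      rewrite usn // (_ : stuffle 0 _ = 0) ?mcoeff0; last exact: linear0 (stuffler _).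
      by rewrite gtn_eqF.
    by rewrite mcoeff_stuffle_b0_exp //; case: eqP => // ->.
  rewrite (eq_bigr _ (fun j _ => E j)).
  have [ns|sn] := ltnP n (size us).
    by rewrite (bigD1 (Ordinal ns)) //= eqxx big1 ?addr0 // => j /negPf; rewrite -val_eqE /= => ->.
  rewrite (nth_default 0 sn) mcoeff0 mulr0 big1 // => j _.
  by rewrite mul0rn.
have vanish n j : (size us - n <= j)%N -> (0 < j)%N -> us`_j = 0.
  elim: n j => [|n IHn] j; first by rewrite subn0 => /(nth_default 0).
  move=> sj j0; apply: adm_zeros_eq0 => // t admt.
  have us0j i : (j < i)%N -> us`_i = 0.
    by move=> ji; apply: IHn; [lia | exact: ltn_trans ji].
  have /esym/eqP := coef j t admt us0j; rewrite mcoeff1.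
  have -> : (FMonom (t ++ nseq j 0%N) == mone) = false.
    by rewrite eq_word fm1; case: (t); case: (j) j0.
  by rewrite mulf_eq0 pnatr_eq0 -leqn0 leqNgt fact_gt0 => /eqP.
apply/malgP => -[t]; case: (boolP (adm (FMonom t))) => admt; last first.
  rewrite (supp_in_coef (us0n 0%N) admt) mcoeff1 eq_word fm1.
  by case: t admt.
have := coef 0%N t admt; rewrite cats0 mul1r => -> // j j0.
by apply: (vanish (size us)); rewrite ?subnn.
Qed.

Lemma reg_one : reg 1 = 1.
Proof.
apply: is_reg_one_unique; rewrite /reg; apply: epsilon_spec.
exists 1; exists [:: 1]; split=> //.
  move=> v; rewrite inE => /eqP-> x /(fsubsetP msuppU_le).
  by rewrite in_fset1 => /eqP->; rewrite /in_mem /= /adm fm1.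
by rewrite big_ord1 -[RHS]/(stuffle 1 1) -bw_nil stuffleUU.
Qed.

(** * The weight on the left factor of [phi] *)

Definition positive_idx (u : symbol) : bool := all (leq 1) (map idx u).

(** [descends ks] holds of the index sequences with positive entries whose
    sum is smaller than that of [ks]. *)
Definition descends (ks ks' : seq nat) : bool :=
  all (leq 1) ks' && (sumn ks' < sumn ks)%N.

Lemma descends_del ks j : all (leq 1) ks -> (j < size ks)%N ->
  descends ks (take j ks ++ drop j.+1 ks).
Proof.
move=> ks1 jks; rewrite /descends; move: ks1.
rewrite -{1 6}(cat_take_drop j ks) (drop_nth 0%N jks) !all_cat /= !sumn_cat /=.
move=> /and3P[-> + ->] /=; lia.
Qed.

Lemma descends_pred ks j : all (leq 1) ks -> (1 < nth 0 ks j)%N ->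
  descends ks (set_nth 0%N ks j (nth 0%N ks j).-1).
Proof.
elim: ks j => [|k ks IHks] [|j] //= /andP[k1 ks1] kj; rewrite /descends /=.
  by rewrite ks1 andbT; apply/andP; split; lia.
by have := IHks j ks1 kj; rewrite /descends k1 => /andP[-> ?] /=; lia.
Qed.

Lemma map_idx_set_nth u j e : (j < size u)%N ->
  map idx (set_nth nilentry u j e) = set_nth 0%N (map idx u) j (idx e).
Proof. by elim: u j => [|e' u IHu] [|j] //= ju; rewrite IHu. Qed.

Lemma map_idx_mul_arg x u j : (j < size u)%N -> map idx (mul_arg x u j) = map idx u.
Proof.
move=> ju; rewrite /mul_arg map_idx_set_nth //=.
by elim: u j ju => [|e' u IHu] [|j] //= ju; rewrite IHu.
Qed.

Lemma map_idx_del u j : map idx (del u j) = take j (map idx u) ++ drop j.+1 (map idx u).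
Proof. by rewrite map_cat map_take map_drop. Qed.

Section Descent.
Variable ks : seq nat.

Let low (u : symbol) : bool := descends ks (map idx u).

Lemma supp_in_tens_low (s : Free symbol) (o : Free omega) : supp_in low s ->
  supp_in (fun p : symbol * omega => low p.1) (tens s o).
Proof.
move=> sl; apply: (@sub_supp_in _ (fun p => low p.1 && predT p.2)).
  by move=> p /andP[].
exact: supp_in_tens.
Qed.

(** An elementary difference lowers the weight: it either decreases an index
    greater than one, or removes an index equal to one. *)
Lemma supp_in_D_up u j : map idx u = ks -> all (leq 1) ks ->
  supp_in (fun p : symbol * omega => low p.1) (D_up u j).
Proof.
move=> uks ks1; have sub := supp_in_subspace (fun p : symbol * omega => low p.1).
have sub' := supp_in_subspace low.
rewrite /D_up; case: ifP => [_|/negbT zj]; first by case: sub.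
(* Beyond the end of [u] the default entry is independent of [z]. *)
have ju : (j < size u)%N.
  by rewrite ltnNge; apply: contra zj => uj; rewrite nth_default.
have lowdel v : map idx v = ks -> low (del v j).
  by move=> vks; rewrite /low map_idx_del vks descends_del // -uks size_map.
case: ifP => [kj|_].
  apply/supp_in_tens_low/supp_inU; rewrite /low map_idx_set_nth // uks /=.
  have -> : idx (nth nilentry u j) = nth 0%N ks j.
    by rewrite -uks (nth_map nilentry).
  by apply: descends_pred; rewrite // -uks (nth_map nilentry).
have lowA : supp_in low (symA u j).
  rewrite /symA; case: (j) ju lowdel => [|i] iu lowdel; apply: supp_inU.
    by rewrite -drop1; have := lowdel u uks; rewrite /del take0.
  by apply: lowdel; rewrite map_idx_mul_arg // ltnW.
have lowB : supp_in low (symB u j).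
  rewrite /symB; case: ifP => [iu|_]; last by case: sub'.
  by apply/supp_inU/lowdel; rewrite map_idx_mul_arg.
case: ifP => _.
  apply: (subspaceD sub); last exact: supp_in_tens_low.
  by apply/(subspaceN sub)/supp_in_tens_low.
by apply: (subspaceB sub); apply: supp_in_tens_low.
Qed.

Lemma supp_in_D u v : map idx u = ks -> map idx v = ks -> all (leq 1) ks ->
  supp_in (fun p : symbol * omega => low p.1) (D u v).
Proof.
move=> uks vks ks1; have sub := supp_in_subspace (fun p : symbol * omega => low p.1).
rewrite /D; case: ifP => _; first exact: supp_in_D_up.
by case: ifP => _; [apply/(subspaceN sub)/supp_in_D_up | case: sub].
Qed.

End Descent.

Lemma map_idx_Std u v : v \in Std u -> map idx v = map idx u.
Proof.
have H r w : map idx w = map idx u -> {in r, forall j, (j < size u)%N} ->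
    v \in w :: scanl shift_z w r -> map idx v = map idx u.
  elim: r w => [|j r IHr] w wu ru; first by rewrite inE => /eqP->.
  rewrite inE => /orP[/eqP->//|]; apply: IHr => [|i ir]; last first.
    by apply: ru; rewrite inE ir orbT.
  by rewrite map_idx_mul_arg // -(size_map idx) wu size_map ru ?mem_head.
apply: H => // j; rewrite mem_sort mem_filter mem_iota.
by move=> /andP[_ /andP[_]].
Qed.

Lemma supp_in_partial u : positive_idx u ->
  supp_in (fun p : symbol * omega => descends (map idx u) (map idx p.1))
    (partial << u >>).
Proof.
move=> u1; rewrite /partial linU.
apply: (subspace_sum (supp_in_subspace _)) => i _ _.
have iStd : (i < (size (Std u)).-1)%N by exact: ltn_ord.
have iStd1 : (i.+1 < size (Std u))%N by rewrite -ltn_predRL.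
by apply: supp_in_D => //; apply/map_idx_Std/mem_nth => //; exact: ltnW.
Qed.

Lemma supp_in_idS (P : pred symbol) (v : Free ((symbol * symbol) * omega)) :
  supp_in (fun p => P p.1.1) v -> supp_in (fun p => P p.1) (idS v).
Proof.
move=> Pv; apply: (subspace_lin (supp_in_subspace _)) => p /Pv Pp.
apply: (@sub_supp_in _ (fun q => P q.1 && predT q.2)); first by move=> q /andP[].
by apply: supp_in_tens => //; apply: supp_inU.
Qed.

Lemma supp_in_phi_step n u : 
  (forall u', positive_idx u' ->
     supp_in (fun p : symbol * symbol => weight p.1 <= weight u')%N
       (phi_rec n << u' >>)) ->
  positive_idx u ->
  supp_in (fun p : symbol * symbol => weight p.1 < weight u)%N
    (idS (tmap (phi_rec n) id (partial << u >>))).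
Proof.
move=> IH u1; apply: (@supp_in_idS (fun s => weight s < weight u)%N).
apply: (subspace_lin (supp_in_subspace _)) => -[s o].
move=> /(supp_in_partial u1)/andP[/= s1 su].
apply: (@sub_supp_in _ (fun q => (weight q.1.1 < weight u)%N && predT q.2)).
  by move=> q /andP[].
apply: (@supp_in_tens _ _ (fun q : symbol * symbol => weight q.1 < weight u)%N predT) => //.
apply: sub_supp_in (IH s s1) => q qs.
exact: leq_ltn_trans qs su.
Qed.

Lemma supp_in_phi_rec n u : positive_idx u ->
  supp_in (fun p : symbol * symbol => weight p.1 <= weight u)%N (phi_rec n << u >>).
Proof.
have sub (w : nat) := supp_in_subspace (fun p : symbol * symbol => weight p.1 <= w)%N.
have constw v : supp_in (fun p : symbol * symbol => weight p.1 <= weight v)%N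
    (Const << v >>).
  by rewrite /Const linU; case: ifP => _; [apply: supp_inU | case: (sub (weight v))].
elim: n u => [|n IHn] u u1 /=; apply: (subspaceD (sub _)) => //; first by case: (sub (weight u)).
by apply: sub_supp_in (supp_in_phi_step IHn u1) => p; exact: ltnW.
Qed.

(** Apart from the constant term, [phi u] only involves symbols of smaller
    weight on the left. *)
Lemma phi_lead u : positive_idx u ->
  supp_in (fun p : symbol * symbol => weight p.1 < weight u)%N
    (phi << u >> - Const << u >>).
Proof.
rewrite /phi linU; case wu: (weight u) => [|n] u1 /=.
  by rewrite add0r subrr; case: (supp_in_subspace (fun p : symbol * symbol => weight p.1 < 0)%N).
by rewrite addrK -wu; apply: supp_in_phi_step => // u'; exact: supp_in_phi_rec.
Qed.

(** [wle n w]: the word [w] has weight at most [n], the letter [b_i] having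
    weight [i]. *)
Definition wle (n : nat) (w : word) : bool := (sumn w <= n)%N.

Lemma supp_in_wleM m n (v w : QB) :
  supp_in (wle m) v -> supp_in (wle n) w -> supp_in (wle (m + n)) (v * w).
Proof.
move=> vm wn x /msuppM_le[y [z [/vm ym /wn zn ->]]].
by rewrite unfold_in /wle fmM sumn_cat leq_add.
Qed.

Lemma supp_in_wle_b m n : (m <= n)%N -> supp_in (wle n) (b m).
Proof. by move=> mn; apply: supp_inU; rewrite /wle /= addn0. Qed.

Lemma supp_in_wle_Fpoly (s : seq (nat * nat)) :
  supp_in (wle (sumn (map fst s))) (Fpoly s).
Proof.
elim: s => [|p s IHs].
  by rewrite /Fpoly big_nil -bw_nil; apply: supp_inU.
rewrite /Fpoly big_cons; apply: supp_in_wleM => //.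
apply: (subspace_sum (supp_in_subspace _)) => i _ _.
by apply/(subspaceZ (supp_in_subspace _))/supp_in_wle_b/leq_subr.
Qed.

Lemma supp_in_wle_pi_q u : supp_in (wle (weight u)) (pi_q << u >>).
Proof.
rewrite /pi_q linU.
have := @supp_in_wle_Fpoly [seq (idx e, `|qexp e|%N) | e <- u].
by rewrite -map_comp.
Qed.

(** * The BZ dual of an index *)

(** The pairs [(d_i, c_i)] of positive integers encoding an index. *)
Definition positive_blocks (s : seq (nat * nat)) : bool :=
  all (fun p => (0 < p.1)%N && (0 < p.2)%N) s.

(** BZ duality on the encoding by blocks. *)
Definition dual_blocks (s : seq (nat * nat)) : seq (nat * nat) :=
  [seq (p.2, p.1) | p <- rev s].

Lemma positive_dual_blocks s : positive_blocks (dual_blocks s) = positive_blocks s.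
Proof.
rewrite /positive_blocks /dual_blocks all_map -(all_rev _ s).
by apply: eq_all => p /=; rewrite andbC.
Qed.

Lemma dual_blocksK : involutive dual_blocks.
Proof.
move=> s; rewrite /dual_blocks -map_rev revK -map_comp map_id_in // => -[].
by [].
Qed.

Lemma Ind_BZ_of_blocks s : positive_blocks s -> Ind_BZ (of_blocks s).
Proof.
elim/last_ind: s => [//|s [d c] _]; rewrite /positive_blocks all_rcons => /andP[/= /andP[d0 c0] s0].
rewrite /Ind_BZ /of_blocks map_rcons flatten_rcons /= last_cat last_rcons ltnS c0 andbT.
rewrite all_cat all_rcons /= all_nseq orbT andbT.
elim: s s0 => //= -[d' c'] s IHs /andP[_ s0].
by rewrite all_cat all_rcons /= all_nseq orbT IHs.
Qed.

Section Dual.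
Variable k : seq nat.
Hypothesis kBZ : Ind_BZ k.

Let dualE : dual_BZ k = of_blocks (dual_blocks (blocks k)).
Proof. by []. Qed.

Let k0 : positive_blocks (dual_blocks (blocks k)).
Proof. by rewrite positive_dual_blocks; case: (blocksK kBZ). Qed.

Lemma Ind_BZ_dual : Ind_BZ (dual_BZ k).
Proof. exact: Ind_BZ_of_blocks. Qed.

Lemma dual_BZK : dual_BZ (dual_BZ k) = k.
Proof.
suff: of_blocks (dual_blocks (blocks (dual_BZ k))) = k by [].
by rewrite {1}/dual_BZ of_blocksK // dual_blocksK; case: (blocksK kBZ).
Qed.

End Dual.

(** * The element Theta *)

(** The symbol of the summand of [Theta k] with [epsilon = e]; entries of [e]
    beyond its size are read as zero. *)
Definition theta_symbol (k : seq nat) (e : seq bool) : symbol :=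
  mkseq (fun i => (nth 0%N k i,
    ((nth false e i : nat)%:Z - (nth false e i.+1 : nat)%:Z,
     (nth 0%N k i)%:Z - 1 + (nth false e i.+1 : nat)%:Z))) (size k).

Lemma ThetaE k : Theta k =
  \sum_(e : (size k).-tuple bool) (-1) ^+ count id e *: << theta_symbol k e >>.
Proof. by []. Qed.

Section ThetaSymbol.
Variables (k : seq nat) (e : seq bool).

Lemma map_idx_theta : map idx (theta_symbol k e) = k.
Proof. by rewrite /theta_symbol -map_comp -[RHS](mkseq_nth 0%N). Qed.

Hypotheses (kBZ : Ind_BZ k) (sek : size e = size k).

Let k_gt0 i : (i < size k)%N -> (0 < nth 0%N k i)%N.
Proof. by move=> ik; case/andP: kBZ => /all_nthP + _; apply. Qed.

Lemma positive_theta : positive_idx (theta_symbol k e).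
Proof. by rewrite /positive_idx map_idx_theta; case/andP: kBZ. Qed.

Let sum_fst (r : seq (int * int)) : (\sum_(x <- r) x).1 = \sum_(x <- r) x.1.
Proof. exact: (big_morph fst (id1 := 0) (op1 := +%R)). Qed.

Let sum_snd (r : seq (int * int)) : (\sum_(x <- r) x).2 = \sum_(x <- r) x.2.
Proof. exact: (big_morph snd (id1 := 0) (op1 := +%R)). Qed.

Let last_k : (0 < size k)%N -> (1 < nth 0%N k (size k).-1)%N.
Proof.
by case/andP: kBZ => _ + k0; rewrite nth_last; case: (k) k0.
Qed.

Lemma theta_in_Fn0 : in_Fn 0 (theta_symbol k e).
Proof.
apply/andP; split; last first.
  apply/allP => _ /mapP[i + ->]; rewrite mem_iota /= => ik; rewrite /qexp /idx /=.
  by have := k_gt0 ik; case: (nth false e i.+1); lia.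
apply/andP; split.
  apply/allP => _ /mapP[i + ->]; rewrite mem_iota /= => ik.
  rewrite /idx /zexp /= k_gt0 //.
  by case: (nth false e i); case: (nth false e i.+1).
apply/allP => i; rewrite mem_iota size_mkseq /= add0n => ik.
have -> : drop i (theta_symbol k e) =
    [seq (nth 0%N k j,
    ((nth false e j : nat)%:Z - (nth false e j.+1 : nat)%:Z,
     (nth 0%N k j)%:Z - 1 + (nth false e j.+1 : nat)%:Z)) | j <- index_iota i (size k)].
  by rewrite /theta_symbol /mkseq -map_drop drop_iota add0n.
(* The exponent of [z] in the product of the arguments from position [i] on
   telescopes to [epsilon_i]; if it is 0, the exponent of [q] is at least
   [k_d - 1 > 0]. *)
rewrite -(big_map arg predT id) /tail_ok sum_fst sum_snd !big_map /=.
have -> : \sum_(j <- index_iota i (size k))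
    ((nth false e j : nat)%:Z - (nth false e j.+1 : nat)%:Z) = (nth false e i : nat)%:Z.
  rewrite -[LHS]opprK -sumrN (eq_bigr _ (fun j _ => opprB _ _)).
  rewrite (telescope_sumr (fun j => (nth false e j : nat)%:Z)) 1?ltnW //.
  by rewrite opprB (@nth_default _ false e (size k)) ?sek //= subr0.
case: (nth false e i) => //=.
have sz : size k = (size k).-1.+1 by rewrite prednK // (leq_ltn_trans _ ik).
rewrite sz big_nat_recr /=; last by rewrite -ltnS -sz.
apply: ltr_wpDl; last by have := last_k (leq_ltn_trans (leq0n i) ik); lia.
rewrite big_seq; apply: sumr_ge0 => j; rewrite mem_index_iota => /andP[_ jk].
by have := @k_gt0 j; lia.
Qed.

Lemma theta_in_G : in_G (theta_symbol k e).
Proof.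
rewrite /in_G theta_in_Fn0 /= -size_eq0 size_mkseq.
case: eqP => //= /eqP; rewrite -lt0n => k0.
rewrite -nth_last size_mkseq nth_mkseq ?prednK //.
apply/eqP => -[_]; have := last_k k0; lia.
Qed.

Lemma theta_in_C : in_C (theta_symbol k e) = (e == nseq (size k) false).
Proof.
rewrite /in_C theta_in_Fn0 andbT; apply/allP/eqP => [z|-> _ /mapP[i _ ->]]; last first.
  by rewrite /zexp /= !nth_nseq !if_same.
have step i : (i < size k)%N -> nth false e i = nth false e i.+1.
  move=> ik; have /z : (nth nilentry (theta_symbol k e) i) \in theta_symbol k e.
    by rewrite mem_nth ?size_mkseq.
  rewrite nth_mkseq // /zexp /= subr_eq0 => /eqP.
  by case: (nth false e i); case: (nth false e i.+1).
(* [e] is constant, and zero beyond its size. *)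
have e0 d i : (size k - d <= i)%N -> nth false e i = false.
  elim: d i => [|d IHd] i; first by rewrite subn0 => ki; rewrite nth_default ?sek.
  move=> ki; have [ik|ik] := ltnP i (size k); last by rewrite nth_default ?sek.
  by rewrite step // IHd //; lia.
apply: (@eq_from_nth _ false); rewrite ?size_nseq // => i _.
by rewrite (e0 (size k)) ?subnn // nth_nseq if_same.
Qed.

End ThetaSymbol.

Lemma Theta_in_G k : Ind_BZ k -> supp_in in_G (Theta k).
Proof.
move=> kBZ; rewrite ThetaE; have sub := supp_in_subspace in_G.
apply: (subspace_sum sub) => e _ _; apply/(subspaceZ sub)/supp_inU.
by apply: theta_in_G; rewrite ?size_tuple.
Qed.

(** Flipping the first entry of [e] pairs off summands of opposite sign. *)
Lemma signed_sum_eq0 (V : lmodType rat) n (G : seq bool -> V) :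
  (forall c c' t, G (c :: t) = G (c' :: t)) ->
  \sum_(e : n.+1.-tuple bool) (-1) ^+ count id e *: G e = 0.
Proof.
move=> Gbehead; set s := (X in X = 0).
pose flip (e : n.+1.-tuple bool) : n.+1.-tuple bool :=
  [tuple of ~~ thead e :: behead e].
have flipK : involutive flip.
  by move=> e; apply/val_inj; case: (tupleP e) => c t; rewrite /= !theadE negbK.
have ss : s = - s.
  rewrite {1}/s (reindex_inj (inv_inj flipK)) /s -sumrN; apply: eq_bigr => e _.
  case: (tupleP e) => c t; rewrite /= theadE -scaleNr (Gbehead _ c).
  congr (_ *: _); rewrite !exprD.
  by case: c; rewrite ?expr0 ?expr1 ?mulN1r ?mul1r ?opprK.
have : 2%:R *: s = 0 by rewrite scaler_nat mulr2n {1}ss addNr.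
by move/eqP; rewrite scaler_eq0 /= => /eqP.
Qed.

(** Once [z = 1], the summands of [Theta k] depend on [epsilon_1] by their sign
    only. *)
Lemma pi_q_at_z1_Theta k : k != [::] -> pi_q (at_z1 (Theta k)) = 0.
Proof.
case: k => // k0 k _; rewrite ThetaE -[LHS]/((pi_q \o at_z1) _) linear_sum.
rewrite -[RHS](@signed_sum_eq0 _ (size k)
  (fun e => pi_q (at_z1 << theta_symbol (k0 :: k) e >>))) => [|c c' t].
  by apply: eq_bigr => e _; rewrite linearZ.
rewrite /at_z1 !linU; congr (pi_q << _ >>).
by rewrite /theta_symbol /mkseq -!map_comp; apply: eq_map => i /=.
Qed.

Lemma pi_q_theta0 k : all (leq 1) k ->
  pi_q << theta_symbol k (nseq (size k) false) >> = F_BZ k.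
Proof.
move=> k1; rewrite /pi_q linU /Fpoly /F_BZ big_map /theta_symbol /mkseq big_map.
rewrite [RHS](big_nth 0%N) /index_iota subn0; apply: eq_big_seq => i.
rewrite mem_iota /= => ik; rewrite /idx /qexp /= !nth_nseq !if_same /= addr0.
have ki : (0 < nth 0%N k i)%N by apply: (all_nthP 0%N k1).
have -> : `|(nth 0%N k i)%:Z - 1|%N = (nth 0%N k i).-1 by lia.
have -> : (nth 0%N k i - (nth 0%N k i).-1 = 1)%N by lia.
by rewrite big_ord_recl big_ord1 /= bin0 bin1 !scale1r subn0 subn1.
Qed.

Lemma pi_q_nil : pi_q << [::] >> = 1.
Proof. by rewrite /pi_q linU /Fpoly big_nil. Qed.

Lemma phi_pi_linear : linear phi_pi.
Proof. by move=> a u v; rewrite /phi_pi !linearP. Qed.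

HB.instance Definition _ := GRing.isLinear.Build rat (Free symbol)
  (Free (word * word)) *:%R phi_pi phi_pi_linear.

(** The component of [phi_pi (Theta k)] of top left weight is [F_BZ k (x) 1]. *)
Lemma phi_pi_Theta_lead k : k != [::] -> Ind_BZ k ->
  supp_in (fun p : word * word => sumn p.1 < sumn k)%N
    (phi_pi (Theta k) - tens (F_BZ k) 1).
Proof.
move=> kn kBZ; have /andP[k1 _] := kBZ.
set P := fun p : word * word => (sumn p.1 < sumn k)%N.
have sub := supp_in_subspace P.
have k_gt0 : (0 < sumn k)%N by case: (k) kn k1 => //= i l _ /andP[]; lia.
pose e0 : (size k).-tuple bool := [tuple of nseq (size k) false].
have C (e : (size k).-tuple bool) :
    tmap pi_q pi_q (Const << theta_symbol k e >>) = (e == e0)%:R *: tens (F_BZ k) 1.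
  have -> : Const << theta_symbol k e >>
      = (e == e0)%:R *: << (theta_symbol k e, [::] : symbol) >>.
    rewrite /Const linU theta_in_C ?size_tuple //.
    have -> : (tval e == nseq (size k) false) = (e == e0) by [].
    by case: (e == e0); rewrite /= ?mulr1n ?mulr0n ?scale1r ?scale0r.
  rewrite linearZ; case: eqP => [->|_]; last by rewrite /= mulr0n !scale0r.
  congr (_ *: _); apply: etrans (tmapU _ _ _ _) _.
  exact: (congr2 (@tens word word) (pi_q_theta0 k1) pi_q_nil).
have -> : phi_pi (Theta k) - tens (F_BZ k) 1 =
    \sum_(e : (size k).-tuple bool) (-1) ^+ count id e *:
      tmap pi_q pi_q (phi << theta_symbol k e >> - Const << theta_symbol k e >>).
  transitivity (\sum_(e : (size k).-tuple bool) (-1) ^+ count id e *: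
      (phi_pi << theta_symbol k e >> - (e == e0)%:R *: tens (F_BZ k) 1)); last first.
    apply: eq_bigr => e _; rewrite -(C e); congr (_ *: _).
    exact/esym/(linearB (tmap pi_q pi_q)).
  rewrite ThetaE linear_sum.
  under [RHS]eq_bigr do rewrite scalerBr.
  rewrite sumrB; congr (_ - _); first by apply: eq_bigr => e _; rewrite linearZ.
  rewrite (bigD1 e0) //= big1 => [|e /negPf->]; last by rewrite scale0r scaler0.
  rewrite eqxx scale1r addr0 (_ : count id _ = 0%N) ?scale1r //.
  by elim: (size k).
apply: (subspace_sum sub) => e _ _; apply: (subspaceZ sub).
apply: (subspace_lin sub) => -[s t] st; rewrite /= -/pi_q.
have := phi_lead (positive_theta e kBZ) st.
rewrite unfold_in /= /weight map_idx_theta => sk.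
apply: (@sub_supp_in _ (fun p => wle (weight s) p.1 && predT p.2)).
  by move=> p /andP[ps _]; exact: leq_ltn_trans ps sk.
by apply: supp_in_tens => //; exact: supp_in_wle_pi_q.
Qed.

(** * The ideal *)

Section Ideal.
Variables (R : comNzRingType) (P : R -> Prop).

Lemma gen_ideal0 : gen_ideal P 0.
Proof. by exists [::]; rewrite ?big_nil. Qed.

Lemma gen_idealD x y : gen_ideal P x -> gen_ideal P y -> gen_ideal P (x + y).
Proof.
move=> [s sP ->] [t tP ->]; exists (s ++ t); last by rewrite big_cat.
by move=> p; rewrite mem_cat => /orP[/sP|/tP].
Qed.

Lemma gen_idealMl a x : gen_ideal P x -> gen_ideal P (a * x).
Proof.
move=> [s sP ->]; exists [seq (a * p.1, p.2) | p <- s].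
  by move=> _ /mapP[p /sP ? ->].
by rewrite big_map mulr_sumr; apply: eq_bigr => p _; rewrite mulrA.
Qed.

Lemma gen_ideal_gen x : P x -> gen_ideal P x.
Proof.
move=> Px; exists [:: (1, x)]; last by rewrite big_seq1 mul1r.
by move=> p; rewrite inE => /eqP->.
Qed.

End Ideal.

Lemma gen_ideal_subspace (P : SymQB0 -> Prop) : subspace (gen_ideal P).
Proof.
split=> [|a u v Pu Pv]; first exact: gen_ideal0.
by apply: gen_idealD => //; rewrite -mul_malgC; apply: gen_idealMl.
Qed.

(** * The projection onto V_BZ *)

(** A linear projection of [QB] onto [V_BZ]: expand in the basis of all the
    products of letters [b_i + b_{i-1}] (with [b_0] for [i = 0]) and drop the
    products not indexed by [Ind_BZ]. *)
Definition proj_BZ (v : QB) : QB :=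
  lin (fun w : word => if Ind_BZ w then F_BZ w else 0) (coord_BZ v).

Lemma proj_BZ_linear : linear proj_BZ.
Proof. by move=> a u v; rewrite /proj_BZ !linearP. Qed.

HB.instance Definition _ :=
  GRing.isLinear.Build rat QB QB *:%R proj_BZ proj_BZ_linear.

Lemma proj_BZ_F k : Ind_BZ k -> proj_BZ (F_BZ k) = F_BZ k.
Proof.
by move=> kBZ; rewrite /proj_BZ coord_BZ_F ?linU /= ?kBZ //; case/andP: kBZ.
Qed.

Lemma proj_BZ_id v : V_BZ v -> proj_BZ v = v.
Proof.
move=> [c cBZ ->].
by apply: (subspace_lin (eq_subspace proj_BZ idfun)) => k /cBZ /proj_BZ_F.
Qed.

Lemma tmap_proj_BZ_id t : V_BZ_tens t -> tmap proj_BZ id t = t.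
Proof.
move=> [s sBZ ->]; apply: (subspace_sum (eq_subspace (tmap proj_BZ id) idfun)).
move=> p /sBZ pBZ _; rewrite [LHS](tmap_tens proj_BZ idfun) /=.
by rewrite proj_BZ_id.
Qed.

Lemma supp_in_wle_coord_BZ (w : word) : supp_in (wle (sumn w)) (coord_BZ << w >>).
Proof.
rewrite /coord_BZ linU; elim: (w : seq nat) => [|i s IHs].
  by rewrite big_nil -bw_nil; apply: supp_inU.
rewrite big_cons; apply: supp_in_wleM => //.
apply: (subspace_sum (supp_in_subspace _)) => j _ _.
by apply/(subspaceZ (supp_in_subspace _))/supp_in_wle_b; rewrite -ltnS.
Qed.

(** * The map multiplying the left factor by the regularized right factor *)

Lemma m_odot_tens (v w : QB) : m_odot (tens v w) = sym_inj v * sym_inj w.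
Proof.
rewrite /sym_inj /lin mulr_suml -/(lin _ _) tensE (linear_sum m_odot).
apply: eq_bigr => x _; rewrite linearZ -scalerAl mulr_sumr; congr (_ *: _).
rewrite (linear_sum m_odot); apply: eq_bigr => y _.
rewrite linearZ -scalerAr; congr (_ *: _).
by apply: etrans (linU _ _) _; rewrite /sym_inj !linU.
Qed.

(** The map [m_odot o (id (x) reg)] of the confluence relations. *)
Definition conf_lhs (t : Free (word * word)) : SymQB0 := m_odot (tmap id reg t).

Lemma conf_lhs_linear : linear conf_lhs.
Proof. by move=> a u v; rewrite /conf_lhs !linearP. Qed.

HB.instance Definition _ := GRing.isLinear.Build rat (Free (word * word))
  SymQB0 *:%R conf_lhs conf_lhs_linear.

Lemma conf_lhs_tens v (y : word) :
  conf_lhs (tens v << y >>) = sym_inj v * sym_inj (reg << y >>).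
Proof. by rewrite /conf_lhs [tmap _ _ _](tmap_tensl idfun) m_odot_tens. Qed.

(** The map [m_odot o ((id - tau_BZ) (x) reg)]. *)
Definition dual_defect (t : Free (word * word)) : SymQB0 :=
  conf_lhs t - conf_lhs (tmap tau_BZ id t).

Lemma dual_defect_linear : linear dual_defect.
Proof. exact: (linear_sub conf_lhs (conf_lhs \o tmap tau_BZ id)). Qed.

HB.instance Definition _ := GRing.isLinear.Build rat (Free (word * word))
  SymQB0 *:%R dual_defect dual_defect_linear.

Lemma dual_defect_tens v (y : word) : dual_defect (tens v << y >>)
  = sym_inj (v - tau_BZ v) * sym_inj (reg << y >>).
Proof.
have E : tmap tau_BZ id (tens v << y >>) = tens (tau_BZ v) << y >>.
  exact: (tmap_tensl tau_BZ id).
apply: etrans (congr2 (fun s s' => s - s') (conf_lhs_tens v y)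
  (etrans (congr1 conf_lhs E) (conf_lhs_tens (tau_BZ v) y))) _.
rewrite (linearB sym_inj).
exact/esym/mulrBl.
Qed.

(** * Duality relations and the ideal *)

(** The relation [v = tau_BZ v] holds modulo the confluence relations. *)
Definition dual_in_ideal (v : QB) : Prop :=
  gen_ideal CF_generator (sym_inj (v - tau_BZ v)).

Lemma id_minus_tau_linear : linear (fun v => v - tau_BZ v).
Proof. exact: (linear_sub idfun tau_BZ). Qed.

(** The map whose image on [V_BZ] is the space of duality relations. *)
Definition id_minus_tau (v : QB) : QB := v - tau_BZ v.

HB.instance Definition _ :=
  GRing.isLinear.Build rat QB QB *:%R id_minus_tau id_minus_tau_linear.

Lemma dual_in_ideal_subspace : subspace dual_in_ideal.
Proof. exact: (subspace_preim (sym_inj \o id_minus_tau)) (gen_ideal_subspace _). Qed.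

(** Modulo the ideal the empty word of degree one is the unit. *)
Lemma gen_ideal_sym_one v : gen_ideal CF_generator (sym_inj v * sym_inj 1) ->
  gen_ideal CF_generator (sym_inj v).
Proof.
have E (R : comNzRingType) (x y : R) : x * y - x * (y - 1) = x.
  by rewrite mulrBr mulr1 subKr.
move=> v1; rewrite -(E _ (sym_inj v) (sym_inj 1)).
exact: (subspaceB (gen_ideal_subspace _) v1 (gen_idealMl _ (gen_ideal_gen CF_unit))).
Qed.

Lemma conf_lhs_Theta k : k != [::] -> Ind_BZ k ->
  gen_ideal CF_generator (conf_lhs (phi_pi (Theta k))).
Proof.
move=> kn kBZ; apply: gen_ideal_gen.
have := CF_conf (Theta_in_G kBZ).
by rewrite pi_q_at_z1_Theta // linear0 subr0.
Qed.

(** The duality relations on the spanning family, by induction on the weight. *)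
Lemma dual_in_ideal_F_BZ :
  (forall k : seq nat, Ind_BZ k ->
     V_BZ_tens (phi_pi (Theta k)) /\
     phi_pi (Theta k) = tmap tau_BZ id (phi_pi (Theta (dual_BZ k)))) ->
  forall k, Ind_BZ k -> dual_in_ideal (F_BZ k).
Proof.
move=> H k; move: {2}(sumn k).+1 (ltnSn (sumn k)) => n.
elim: n k => // n IHn k kn kBZ.
have subJ := gen_ideal_subspace CF_generator.
have [->|kne] := eqVneq k [::].
  by rewrite /dual_in_ideal tau_BZ_F // subrr linear0; exact: gen_ideal0.
have kdBZ := Ind_BZ_dual kBZ.
have kdne : dual_BZ k != [::].
  by apply: contra kne => /eqP kd; rewrite -(dual_BZK kBZ) kd.
have [kV _] := H k kBZ; have [_ kdE] := H _ kdBZ.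
rewrite dual_BZK // in kdE.
set t := phi_pi (Theta k) in kV kdE.
have Nt : gen_ideal CF_generator (dual_defect t).
  by apply: (subspaceB subJ); rewrite -?kdE; exact: conf_lhs_Theta.
(* The leading term is in [V_BZ (x) QB] together with [t], hence so is [r]. *)
pose r := t - tens (F_BZ k) 1.
have rE : tmap proj_BZ id r = r.
  apply: etrans (linearB (tmap proj_BZ id) _ _) _.
  congr (_ - _); first exact: tmap_proj_BZ_id.
  apply: etrans (tmap_tensl proj_BZ id _ _) _.
  exact: (congr1 (fun v => tens v << mone >>) (proj_BZ_F kBZ)).
have Nr : gen_ideal CF_generator (dual_defect r).
  rewrite -rE; apply: (subspace_lin (subspace_preim dual_defect subJ)) => -[x y] xyr.
  have xk := phi_pi_Theta_lead kne kBZ xyr.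
  apply: (eq_ind_r (gen_ideal CF_generator) _ (dual_defect_tens (proj_BZ << x >>) y)).
  rewrite mulrC; apply: gen_idealMl.
  apply: (subspace_lin dual_in_ideal_subspace) => l /supp_in_wle_coord_BZ lx.
  case: ifP => lBZ; last by case: dual_in_ideal_subspace.
  apply: IHn => //; apply: leq_ltn_trans lx _; exact: leq_trans xk _.
apply: gen_ideal_sym_one; rewrite -{1}reg_one.
apply: (eq_ind _ (gen_ideal CF_generator) _ _ (dual_defect_tens (F_BZ k) mone)).
have tr : tens (F_BZ k) << mone >> = t - r by rewrite /r subKr.
have D : dual_defect (t - r) = dual_defect t - dual_defect r := linearB dual_defect t r.
apply: (eq_ind_r (fun s => gen_ideal CF_generator (dual_defect s)) _ tr).
apply: (eq_ind_r (gen_ideal CF_generator) _ D).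
exact: (subspaceB subJ Nt Nr).
Qed.

Lemma QB0_F_BZ k : Ind_BZ k -> QB0 (F_BZ k).
Proof.
elim/last_ind: k => [_|k i _].
  by rewrite /F_BZ big_nil -bw_nil; apply: supp_inU.
case/andP=> _; rewrite last_rcons => i1; rewrite /F_BZ -cats1 big_cat big_seq1 => w.
move=> /msuppM_le[x [y [_ yi ->]]]; rewrite unfold_in /adm fmM last_cat.
have: supp_in (fun w : word => last 0%N w != 0%N) (b i + b i.-1).
  by apply: (subspaceD (supp_in_subspace _)); apply: supp_inU => /=; lia.
move=> /(_ _ yi); rewrite unfold_in; case: y {yi} => -[] //.
Qed.

Theorem theorem41 :
  (forall k : seq nat, Ind_BZ k ->
     V_BZ_tens (phi_pi (Theta k)) /\
     phi_pi (Theta k) = tmap tau_BZ id (phi_pi (Theta (dual_BZ k)))) ->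
  forall v : {malg rat[{fmonom nat}]}, I_BZ_dual v -> I_CF v.
Proof.
move=> H _ [_ [c cBZ ->] ->]; split.
  apply: (subspace_lin (subspace_preim id_minus_tau (supp_in_subspace adm))).
  move=> k /cBZ kBZ; have FkBZ := QB0_F_BZ (Ind_BZ_dual kBZ).
  rewrite -(tau_BZ_F kBZ) in FkBZ.
  exact: (subspaceB (supp_in_subspace adm) (QB0_F_BZ kBZ) FkBZ).
by apply: (subspace_lin dual_in_ideal_subspace) => k /cBZ; exact: dual_in_ideal_F_BZ.
Qed.
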